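(* Let $G=(V,E)$ be a finite graph and let $(K_e)_{e\in E}$ be independent nonnegative random variables, each finite almost surely. Define $$K_e^{\mathrm{eff}}=-\frac12\log\mathbb E\,e^{-2K_e},\qquad e\in E.$$ Then for every $a\in\mathbb Z^V$, $$\mathbb E\,C_a(K)\ge C_a(K^{\mathrm{eff}}),$$ where $K=(K_e)_{e\in E}$ and $K^{\mathrm{eff}}=(K_e^{\mathrm{eff}})_{e\in E}$.
   Context: Let $\mathbb T=\mathbb R/(2\pi\mathbb Z)$. For a finite graph $G=(V,E)$ and couplings $J=(J_e)_{e\in E}$ with $J_e\ge0$, the XY Gibbs measure is $$d\mu_{G,J}(\theta)=\frac1{Z_{G,J}}\exp\Bigl(\sum_{e=\{u,v\}\in E}J_e\cos(\theta_u-\theta_v)\Bigr)\prod_{v\in V}\frac{d\theta_v}{2\pi},\qquad\theta\in\mathbb T^V,$$ with expectation $\langle\cdot\rangle_{G,J}$. For $a\in\mathbb Z^V$, set $C_a(J)=\langle\cos(a\cdot\theta)\rangle_{G,J}$, where $a\cdot\theta=\sum_{v\in V}a_v\theta_v$. *)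

(* Defs.v *)
From HB Require Import structures.
From mathcomp Require Import all_boot all_order all_algebra.
From mathcomp Require Import all_classical all_reals all_analysis.
From mathcomp Require Import measurable_realfun.

Set Implicit Arguments.
Unset Strict Implicit.
Unset Printing Implicit Defensive.

Import Order.TTheory GRing.Theory Num.Theory.
Import numFieldNormedType.Exports.

Local Open Scope classical_set_scope.
Local Open Scope ring_scope.

Record sgraph := SGraph {
  vertex :> finType;
  edges : {set {set vertex}};
  edges_card2 : forall e : {set vertex}, e \in edges -> #|e| = 2%N
}.

Definition edge (G : sgraph) : finType := {e : {set G} | e \in edges G}.

Section product_probability.
Context d (T : measurableType d) (R : realType).

Definition tuple_cons n (x : T * n.-tuple T) : n.+1.-tuple T :=
  [tuple of x.1 :: x.2].

Lemma measurable_tuple_cons n : measurable_fun setT (@tuple_cons n).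
Proof. exact: measurable_cons. Qed.

HB.instance Definition _ n :=
  isMeasurableFun.Build _ _ _ _ (@tuple_cons n) (@measurable_tuple_cons n).

Section binary_product.
Context d' (T' : measurableType d').
Variables (P : probability T R) (Q : probability T' R).

Definition prod_prob : set (T * T') -> \bar R := (P \x Q)%E.

HB.instance Definition _ := Measure.on prod_prob.

Lemma prod_prob_setT : prod_prob setT = 1%E.
Proof.
rewrite /prod_prob -setXTT (@product_measure1E _ _ _ _ _ P Q)//.
by rewrite [X in (X * _)%E]probability_setT [X in (_ * X)%E]probability_setT mule1.
Qed.

HB.instance Definition _ :=
  Measure_isProbability.Build _ _ _ prod_prob prod_prob_setT.

End binary_product.

Variable P : probability T R.

Fixpoint tuple_prob n : probability (n.-tuple T) R :=
  if n is n'.+1 then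
    distribution (prod_prob P (tuple_prob n')) (@tuple_cons n')
  else dirac [tuple].

End product_probability.

Section xy_model.
Context (R : realType) (G : sgraph).

Lemma two_pi_gt0 : 0 < 2 * pi :> R.
Proof. by rewrite mulr_gt0// pi_gt0. Qed.

(* The circle R/(2 pi Z) is represented by its fundamental domain [0, 2 pi];
   all the observables below are 2 pi-periodic in each angle. *)
Definition angle_prob : probability (measurableTypeR R) R :=
  uniform_prob two_pi_gt0.

Definition config := #|G|.-tuple (measurableTypeR R).

Definition angle (theta : config) (v : G) : R := tnth theta (enum_rank v).

Definition torus_prob : probability config R := tuple_prob angle_prob #|G|.

(* The choice of orientation of the edge is irrelevant, see [edge_cosE]. *)
Definition edge_cos (e : edge G) (theta : config) : R :=
  if [pick p : G * G | val e == [set p.1; p.2]%SET] is Some p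
  then cos (angle theta p.1 - angle theta p.2) else 0.

Lemma edge_cosE (e : edge G) (u v : G) (theta : config) :
  val e = [set u; v]%SET -> edge_cos e theta = cos (angle theta u - angle theta v).
Proof.
move=> euv; rewrite /edge_cos; case: pickP => [[x y]/= /eqP exy|/(_ (u, v))]; last first.
  by rewrite /= euv eqxx.
have {}exy : val e = [set x; y]%SET := exy.
have xy : x != y.
  by have := edges_card2 (valP e); rewrite exy cards2; case: (x != y).
have : x \in val e by rewrite exy !inE eqxx.
have : y \in val e by rewrite exy !inE eqxx orbT.
rewrite euv !inE => /orP[]/eqP yE /orP[]/eqP xE; rewrite xE yE ?eqxx// in xy *.
by rewrite -opprB cosN.
Qed.

Definition interaction (J : edge G -> R) (theta : config) : R :=
  \sum_(e : edge G) J e * edge_cos e theta.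

Definition partition_function (J : edge G -> R) : R :=
  \int[torus_prob]_theta expR (interaction J theta).

Definition gibbs_pdf (J : edge G -> R) (theta : config) : R :=
  (partition_function J)^-1 * expR (interaction J theta).

Definition gibbs (J : edge G -> R) (A : set config) : \bar R :=
  (\int[torus_prob]_(theta in A) (gibbs_pdf J theta)%:E)%E.

Lemma measurable_angle (v : G) : measurable_fun setT (angle ^~ v).
Proof. exact: measurable_tnth. Qed.

Lemma measurable_edge_cos (e : edge G) : measurable_fun setT (edge_cos e).
Proof.
rewrite /edge_cos; case: pickP => [p _|_]; last exact: measurable_cst.
apply: measurableT_comp; first by apply: continuous_measurable_fun; exact: continuous_cos.
by apply: measurable_funB; exact: measurable_angle.
Qed.

Lemma measurable_expR_interaction (J : edge G -> R) :
  measurable_fun setT (fun theta => expR (interaction J theta)).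
Proof.
apply: measurableT_comp => //; apply: measurable_sum => e.
by apply: measurable_funM => //; exact: measurable_edge_cos.
Qed.

Lemma edge_cos_le1 e theta : `|edge_cos e theta| <= 1.
Proof.
rewrite /edge_cos; case: pickP => [p _|_]; last by rewrite normr0.
by rewrite ler_norml cos_geN1 cos_le1.
Qed.

Lemma interaction_bound J theta : `|interaction J theta| <= \sum_(e : edge G) `|J e|.
Proof.
apply: (le_trans (ler_norm_sum _ _ _)); apply: ler_sum => e _.
by rewrite normrM ler_piMr// edge_cos_le1.
Qed.

Let int_expR_interaction_ge J :
  ((expR (- \sum_(e : edge G) `|J e|))%:E
    <= \int[torus_prob]_theta (expR (interaction J theta))%:E)%E.
Proof.
set m := expR _.
have -> : (m%:E = \int[torus_prob]_theta (cst m%:E theta))%E.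
  by rewrite integral_cst//= probability_setT mule1.
apply: ge0_le_integral => //= [_ _||theta _].
- by rewrite lee_fin expR_ge0.
- by apply/measurable_EFinP; exact: measurable_expR_interaction.
- rewrite lee_fin ler_expR.
  by have := interaction_bound J theta; rewrite ler_norml => /andP[].
Qed.

Let int_expR_interaction_le J :
  (\int[torus_prob]_theta (expR (interaction J theta))%:E
    <= (expR (\sum_(e : edge G) `|J e|))%:E)%E.
Proof.
set m := expR (\sum_(e : edge G) `|J e|).
have -> : (m%:E = \int[torus_prob]_theta (cst m%:E theta))%E.
  by rewrite integral_cst//= probability_setT mule1.
apply: ge0_le_integral => //= [|theta _].
- by apply/measurable_EFinP; exact: measurable_expR_interaction.
- rewrite lee_fin ler_expR.
  by have := interaction_bound J theta; rewrite ler_norml => /andP[].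
Qed.

Lemma partition_functionE J :
  ((partition_function J)%:E
    = \int[torus_prob]_theta (expR (interaction J theta))%:E)%E.
Proof.
rewrite /partition_function /Rintegral fineK// ge0_fin_numE.
  exact: le_lt_trans (int_expR_interaction_le J) (ltry _).
by apply: integral_ge0 => theta _; rewrite lee_fin expR_ge0.
Qed.

Lemma partition_function_gt0 J : 0 < partition_function J.
Proof.
rewrite -lte_fin partition_functionE.
by apply: lt_le_trans (int_expR_interaction_ge J); rewrite lte_fin expR_gt0.
Qed.

Lemma gibbs_pdf_ge0 J theta : 0 <= gibbs_pdf J theta.
Proof.
by rewrite mulr_ge0 ?expR_ge0// invr_ge0 ltW// partition_function_gt0.
Qed.

Lemma measurable_gibbs_pdf J : measurable_fun setT (gibbs_pdf J).
Proof. by apply: measurable_funM => //; exact: measurable_expR_interaction. Qed.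

Section gibbs_probability.
Variable J : edge G -> R.

Let gibbs0 : gibbs J set0 = 0%E.
Proof. by rewrite /gibbs integral_set0. Qed.

Let gibbs_ge0 A : (0 <= gibbs J A)%E.
Proof. by apply: integral_ge0 => theta _; rewrite lee_fin gibbs_pdf_ge0. Qed.

Let gibbs_sigma_additive : semi_sigma_additive (gibbs J).
Proof.
move=> /= F mF tF mUF; rewrite /gibbs; apply: cvg_toP.
  apply: ereal_nondecreasing_is_cvgn => m n mn.
  by apply: lee_sum_nneg_natr => // k _ _; exact: gibbs_ge0.
rewrite ge0_integral_bigcup//=.
- apply: measurable_funTS; apply/measurable_EFinP; exact: measurable_gibbs_pdf.
- by move=> theta _; rewrite lee_fin gibbs_pdf_ge0.
Qed.

HB.instance Definition _ := isMeasure.Build _ _ _ (gibbs J)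
  gibbs0 gibbs_ge0 gibbs_sigma_additive.

Lemma gibbs_setT : gibbs J setT = 1%E.
Proof.
rewrite /gibbs /gibbs_pdf; under eq_integral do rewrite EFinM.
rewrite ge0_integralZl//=.
- by rewrite -partition_functionE -EFinM mulVf// gt_eqF// partition_function_gt0.
- by apply/measurable_EFinP; exact: measurable_expR_interaction.
- by rewrite lee_fin invr_ge0 ltW// partition_function_gt0.
Qed.

HB.instance Definition _ :=
  Measure_isProbability.Build _ _ _ (gibbs J) gibbs_setT.

End gibbs_probability.

Definition xy_correlation (a : G -> int) (J : edge G -> R) : R :=
  \int[gibbs J]_theta cos (\sum_(v : G) (a v)%:~R * angle theta v).

End xy_model.

Section random_couplings.
Context d d' (T : measurableType d) (T' : measurableType d') (R : realType).

Definition mutually_independent (P : probability T R) (I : finType)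
    (X : I -> {RV P >-> T'}) : Prop :=
  forall (A : {set I}) (B : I -> set T'), (forall i, measurable (B i)) ->
    (P (\bigcap_(i in [set` A]) (X i @^-1` B i))
      = \prod_(i in A) P (X i @^-1` B i))%E.

End random_couplings.
Arguments mutually_independent {d d' T T' R} P {I} X.

(* K is almost surely finite, so the expectation is a positive real. *)
Definition effective_coupling d (T : measurableType d) (R : realType)
    (P : probability T R) (K : {RV P >-> \bar R}) : R :=
  - 2^-1 * ln (fine (\int[P]_w expeR (- (2%:E * K w)))%E).
Arguments effective_coupling {d T R} P K.

(* Main.v *)
Require Import Defs.
From HB Require Import structures.
From mathcomp Require Import all_boot all_order all_algebra.
From mathcomp Require Import all_classical all_reals all_analysis.
From mathcomp Require Import measurable_realfun.
From mathcomp Require Import ring lra.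

Set Implicit Arguments.
Unset Strict Implicit.
Unset Printing Implicit Defensive.

Import Order.TTheory GRing.Theory Num.Theory.
Import numFieldNormedType.Exports.

Local Open Scope classical_set_scope.
Local Open Scope ring_scope.

(** Why the inequality holds.

    Fix all couplings but one, J_e = t, and write C(t) for the correlation
    of A = cos (a . theta), X for cos (theta_u - theta_v), and x = e^(-2t).
    Differentiating the Gibbs weight gives
      C' = Cov(A, X)   and   C'' = Cov(A, X^2) - 2 <X> Cov(A, X),
    so the second derivative of C with respect to x is e^(4t) / 4 times
      C'' + 2 C' = Cov(A, X^2) + 2 (1 - <X>) Cov(A, X).
    Since X^2 = (1 + cos (2 theta_u - 2 theta_v)) / 2, both covariances are
    of the form Cov(cos (p . theta), cos (q . theta)), which are nonnegative
    by Ginibre's inequality [ginibre_inequality].  Hence C is a convex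
    function of x, that is, it lies above its tangents: this is
    [support_inequality] and its instance [xy_correlation_support].

    The effective coupling is the one for which e^(-2 K_e^eff) is the mean of
    e^(-2 K_e).  The random couplings are replaced by their effective values
    one at a time [replace_one_coupling].  The tangent at K_e^eff bounds the
    change of the correlation from below by a slope times
    e^(-2 K_e^eff) - e^(-2 K_e).  The slope depends only on the other
    couplings, so it is independent of the second factor, which has mean zero.

    Ginibre's inequality is obtained by duplicating the variables:
      2 (<1> <A B> - <A> <B>) = <(A - A') (B - B')>
    for unnormalised integrals, primes denoting an independent copy.  After
    expanding the exponential of the doubled energy, everything reduces to the
    integral of a product of factors cos (m . theta) +- cos (m . theta').
    Such an integral is a positive multiple of the square of an integer
    [Rintegral_gfactors]: in the variables p + q and p - q the count of
    vanishing frequencies splits into two identical counts. *)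

(** * Bounded measurable functions on a probability space *)

Section bounded_measurable.
Context d (T : measurableType d) (R : realType).
Implicit Types f g : T -> R.

(** A class stable under sums, products, exponentials and composition, and
    contained in L^1 of any probability, so that each integrability side
    condition reduces to membership in it. *)
Definition bmfun f :=
  measurable_fun setT f /\ exists M, forall x, `|f x| <= M.

Lemma bmfun_cst (c : R) : bmfun (fun=> c).
Proof. by split; [exact: measurable_cst|exists `|c|]. Qed.

Lemma bmfunD f g : bmfun f -> bmfun g -> bmfun (fun x => f x + g x).
Proof.
move=> [mf [M fM]] [mg [N gN]]; split; first exact: measurable_funD.
by exists (M + N) => x; rewrite (le_trans (ler_normD _ _))// lerD.
Qed.

Lemma bmfunM f g : bmfun f -> bmfun g -> bmfun (fun x => f x * g x).
Proof.
move=> [mf [M fM]] [mg [N gN]]; split; first exact: measurable_funM.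
by exists (M * N) => x; rewrite normrM ler_pM.
Qed.

Lemma bmfunN f : bmfun f -> bmfun (fun x => - f x).
Proof.
move=> [mf [M fM]]; split; first exact: measurableT_comp.
by exists M => x; rewrite normrN.
Qed.

Lemma bmfunB f g : bmfun f -> bmfun g -> bmfun (fun x => f x - g x).
Proof. by move=> bf bg; exact: bmfunD bf (bmfunN bg). Qed.

Lemma bmfun_expR f : bmfun f -> bmfun (fun x => expR (f x)).
Proof.
move=> [mf [M fM]]; split; first exact: measurableT_comp.
exists (expR M) => x; rewrite ger0_norm ?expR_ge0// ler_expR.
exact: le_trans (ler_norm _) (fM x).
Qed.

Lemma bmfun_sum (I : Type) (s : seq I) (F : I -> T -> R) :
  (forall i, bmfun (F i)) -> bmfun (fun x => \sum_(i <- s) F i x).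
Proof.
move=> bF; elim: s => [|i s IHs].
  by under eq_fun do rewrite big_nil; exact: bmfun_cst.
by under eq_fun do rewrite big_cons; exact: bmfunD.
Qed.

Lemma bmfun_prod (I : Type) (s : seq I) (F : I -> T -> R) :
  (forall i, bmfun (F i)) -> bmfun (fun x => \prod_(i <- s) F i x).
Proof.
move=> bF; elim: s => [|i s IHs].
  by under eq_fun do rewrite big_nil; exact: bmfun_cst.
by under eq_fun do rewrite big_cons; exact: bmfunM.
Qed.

Lemma bmfun_cos f : measurable_fun setT f -> bmfun (fun x => cos (f x)).
Proof.
move=> mf; split.
  apply: measurableT_comp mf.
  by apply: continuous_measurable_fun; exact: continuous_cos.
by exists 1 => x; rewrite ler_norml cos_geN1 cos_le1.
Qed.

Lemma bmfun_sin f : measurable_fun setT f -> bmfun (fun x => sin (f x)).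
Proof.
move=> mf; split.
  apply: measurableT_comp mf.
  by apply: continuous_measurable_fun; exact: continuous_sin.
by exists 1 => x; rewrite ler_norml sin_geN1 sin_le1.
Qed.

Variable P : probability T R.

Lemma bmfun_integrable f : bmfun f -> P.-integrable setT (EFin \o f).
Proof.
move=> [mf [M fM]]; apply: measurable_bounded_integrable => //.
  by rewrite [ltLHS]probability_setT ltry.
exists M; split; first by rewrite num_real.
by move=> N MN x _; exact: le_trans (fM x) (ltW MN).
Qed.

Lemma bmintD f g : bmfun f -> bmfun g ->
  \int[P]_x (f x + g x) = \int[P]_x f x + \int[P]_x g x.
Proof. by move=> bf bg; rewrite RintegralD//; exact: bmfun_integrable. Qed.

Lemma bmintB f g : bmfun f -> bmfun g ->
  \int[P]_x (f x - g x) = \int[P]_x f x - \int[P]_x g x.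
Proof. by move=> bf bg; rewrite RintegralB//; exact: bmfun_integrable. Qed.

Lemma bmintZ (c : R) f : bmfun f ->
  \int[P]_x (c * f x) = c * \int[P]_x f x.
Proof. by move=> bf; rewrite RintegralZl//; exact: bmfun_integrable. Qed.

Lemma bmint_cst (c : R) : \int[P]_x (fun=> c) x = c.
Proof. by rewrite Rintegral_cst// [X in _ * fine X]probability_setT mulr1. Qed.

Lemma bmint_le f g : bmfun f -> bmfun g -> (forall x, f x <= g x) ->
  \int[P]_x f x <= \int[P]_x g x.
Proof.
by move=> bf bg fg; apply: le_Rintegral => //; exact: bmfun_integrable.
Qed.

Lemma bmint_EFin f : bmfun f ->
  (\int[P]_x (f x)%:E)%E = (\int[P]_x f x)%:E.
Proof.
move=> bf; rewrite /Rintegral fineK//.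
exact: integrable_fin_num (bmfun_integrable bf).
Qed.

Lemma bmint_gt0 f : bmfun f -> (forall w, 0 < f w) ->
  0 < \int[P]_w f w.
Proof.
move=> bf f0; rewrite lt_neqAle Rintegral_ge0 ?andbT; last first.
  by move=> w _; exact/ltW.
apply/eqP => /esym If0.
have mf : measurable_fun setT (EFin \o f) by apply/measurable_EFinP; case: bf.
have : (\int[P]_w `|(EFin \o f) w| = 0)%E.
  under eq_integral do rewrite /= ger0_norm ?(ltW (f0 _))//.
  by rewrite bmint_EFin// If0.
move/(ae_eq_integral_abs _ measurableT mf) => -[N [mN N0 fN]].
have : P setT = 0%E.
  apply/eqP; rewrite -measure_le0 -N0 le_measure ?inE//.
  move=> w _; apply: fN => /= /(_ I)[] fw0.
  by have := f0 w; rewrite fw0 ltxx.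
by rewrite probability_setT => /eqP; rewrite onee_eq0.
Qed.

Lemma bmint_sum (I : Type) (s : seq I) (F : I -> T -> R) :
  (forall i, bmfun (F i)) ->
  \int[P]_x (\sum_(i <- s) F i x) = \sum_(i <- s) \int[P]_x F i x.
Proof.
move=> bF; elim: s => [|i s IHs].
  by rewrite big_nil; under eq_Rintegral do rewrite big_nil; rewrite bmint_cst.
rewrite big_cons -IHs -bmintD//; last exact: bmfun_sum.
by under eq_Rintegral do rewrite big_cons.
Qed.

Lemma bmint_cvg (F : nat -> T -> R) f (M : R) :
  (forall n, bmfun (F n)) -> bmfun f ->
  (forall n x, `|F n x| <= M) -> (forall x, F n x @[n --> \oo] --> f x) ->
  \int[P]_x F n x @[n --> \oo] --> \int[P]_x f x.
Proof.
move=> bF bf FM Ff; apply: fine_cvg.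
rewrite fineK ?bmint_EFin//.
rewrite -bmint_EFin//.
apply: (@dominated_cvg _ _ _ P _ _ _ _ (fun=> M%:E)) => //.
- by move=> n; exact: measurable_int (bmfun_integrable (bF n)).
- by move=> x _; apply: cvg_EFin; [exact: nearW|exact: Ff].
- exact: (bmfun_integrable (bmfun_cst M)).
- by move=> n x _; rewrite lee_fin.
Qed.

End bounded_measurable.

Section composition.
Context d d' (T : measurableType d) (T' : measurableType d') (R : realType).

Lemma bmfun_comp (h : T -> T') (f : T' -> R) :
  measurable_fun setT h -> bmfun f -> bmfun (fun x => f (h x)).
Proof.
move=> mh [mf [M fM]]; split; first exact: measurableT_comp mf mh.
by exists M => x.
Qed.

End composition.

Section transfer.
Context d d' (T : measurableType d) (T' : measurableType d') (R : realType).

Lemma bmint_distribution (P : probability T R) (X : {mfun T >-> T'})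
    (f : T' -> R) : bmfun f ->
  \int[distribution P X]_y f y = \int[P]_x f (X x).
Proof.
move=> bf; congr fine; apply: integral_distribution.
  by apply/measurable_EFinP; case: bf.
exact: (bmfun_integrable P (bmfun_comp (measurable_funPT X) bf)).
Qed.

Lemma bmfun_pair (f : T -> R) (g : T' -> R) : bmfun f -> bmfun g ->
  bmfun (fun z : T * T' => f z.1 * g z.2).
Proof.
move=> bf bg; apply: bmfunM; first exact: bmfun_comp bf.
exact: bmfun_comp bg.
Qed.

(** Fubini for a function of product form. *)
Lemma bmint_prod (P : probability T R) (Q : probability T' R)
    (f : T -> R) (g : T' -> R) : bmfun f -> bmfun g ->
  \int[prod_prob P Q]_z (f z.1 * g z.2) = (\int[P]_x f x) * (\int[Q]_y g y).
Proof.
move=> bf bg.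
have bfg := bmfun_pair bf bg.
apply: EFin_inj; rewrite -bmint_EFin//.
have -> : (\int[prod_prob P Q]_z (f z.1 * g z.2)%:E =
    \int[(P \x Q)]_z (EFin \o (fun z : T * T' => (f z.1 * g z.2)%R)) z)%E by [].
rewrite -integral12_prod_meas1; last first.
  exact: (bmfun_integrable (prod_prob P Q) bfg).
have intQ x : (\int[Q]_y (f x * g y)%:E = (f x * \int[Q]_y g y)%:E)%E.
  by rewrite (bmint_EFin Q (bmfunM (bmfun_cst _ (f x)) bg)) bmintZ.
rewrite /fubini_F/=; under eq_integral do rewrite intQ.
rewrite (bmint_EFin P (bmfunM bf (bmfun_cst _ _))).
by under eq_Rintegral do rewrite mulrC; rewrite bmintZ// mulrC.
Qed.

End transfer.

(** * Fourier orthogonality on the torus *)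

Section circle.
Variable R : realType.
Implicit Types f F : R -> R.

Lemma sin_int2pi (k : int) : sin (k%:~R * (2 * pi)) = 0 :> R.
Proof.
have H n : sin (n%:R * (2 * pi)) = 0 :> R.
  rewrite mulr_natl -[_ *+ n]add0r mulr_natl (periodicn (@sinD2pi R)).
  exact: sin0.
case: k => n; first exact: H.
by rewrite NegzE mulrNz mulNr sinN H oppr0.
Qed.

Lemma cos_int2pi (k : int) : cos (k%:~R * (2 * pi)) = 1 :> R.
Proof.
have H n : cos (n%:R * (2 * pi)) = 1 :> R.
  rewrite mulr_natl -[_ *+ n]add0r mulr_natl (periodicn (@cosD2pi R)).
  exact: cos0.
case: k => n; first exact: H.
by rewrite NegzE mulrNz mulNr cosN H.
Qed.

(** The fundamental theorem of calculus over one period.  The trigonometric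
    integrands become nonnegative after adding 1. *)
Lemma Rintegral_angle f F : measurable_fun setT f -> (forall x, 0 <= f x) ->
  continuous f -> (forall x : R, is_derive x (1 : R) F (f x)) ->
  \int[angle_prob R]_x f x = (2 * pi)^-1 * (F (2 * pi) - F 0).
Proof.
move=> mf f0 cf dF.
rewrite /Rintegral integral_uniform/=; last 2 first.
- exact/measurable_EFinP.
- by move=> x; rewrite lee_fin.
rewrite (@continuous_FTC2 _ f F); first by rewrite subr0.
- exact: two_pi_gt0.
- exact: continuous_subspaceT.
- have cF : continuous F.
    move=> x; apply: differentiable_continuous; apply/derivable1_diffP.
    by have [] := dF x.
  by split => [x _||]; [have [] := dF x|exact/cvg_at_right_filter/cF|
    exact/cvg_at_left_filter/cF].
- by move=> x _; rewrite derive1E; have [_ ->] := dF x.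
Qed.

Lemma measurable_scale (c : R) :
  measurable_fun setT (fun x : measurableTypeR R => c * x).
Proof. exact: measurable_funM. Qed.

Lemma Rintegral_angle_cos (k : int) :
  \int[angle_prob R]_x cos (k%:~R * x) = (k == 0)%:R.
Proof.
have [->|k0] := eqVneq k 0.
  by under eq_Rintegral do rewrite mul0r cos0; rewrite bmint_cst.
have k0' : k%:~R != 0 :> R by rewrite intr_eq0.
have bc := bmfun_cos (measurable_scale k%:~R).
have : \int[angle_prob R]_x (1 + cos (k%:~R * x)) = 1.
  have dF (x : R) : is_derive x (1 : R)
      (fun x => x + k%:~R^-1 * sin (k%:~R * x)) (1 + cos (k%:~R * x)).
    by apply: is_derive_eq; rewrite /GRing.scale/=; field.
  have cf : continuous (fun x : R => 1 + cos (k%:~R * x)).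
    move=> x; apply: cvgD; first exact: cvg_cst.
    apply: continuous_comp; last exact: continuous_cos.
    exact: mulrl_continuous.
  rewrite (Rintegral_angle _ _ cf dF).
  - rewrite sin_int2pi !mulr0 sin0 mulr0 !addr0 subr0 mulVf//.
    by rewrite gt_eqF// two_pi_gt0.
  - by case: (bmfunD (bmfun_cst _ 1) bc).
  - by move=> x; have := cos_geN1 (k%:~R * x : R); lra.
rewrite bmintD//; last exact: bmfun_cst.
by rewrite bmint_cst => /eqP; rewrite -subr_eq0 addrAC subrr add0r => /eqP.
Qed.

Lemma Rintegral_angle_sin (k : int) :
  \int[angle_prob R]_x sin (k%:~R * x) = 0.
Proof.
have [->|k0] := eqVneq k 0.
  by under eq_Rintegral do rewrite mul0r sin0; rewrite bmint_cst.
have k0' : k%:~R != 0 :> R by rewrite intr_eq0.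
have bc := bmfun_sin (measurable_scale k%:~R).
have : \int[angle_prob R]_x (1 + sin (k%:~R * x)) = 1.
  have dF (x : R) : is_derive x (1 : R)
      (fun x => x - k%:~R^-1 * cos (k%:~R * x)) (1 + sin (k%:~R * x)).
    by apply: is_derive_eq; rewrite /GRing.scale/=; field.
  have cf : continuous (fun x : R => 1 + sin (k%:~R * x)).
    move=> x; apply: cvgD; first exact: cvg_cst.
    apply: continuous_comp; last exact: continuous_sin.
    exact: mulrl_continuous.
  rewrite (Rintegral_angle _ _ cf dF).
  - rewrite cos_int2pi mulr0 cos0 add0r opprK subrK mulVf//.
    by rewrite gt_eqF// two_pi_gt0.
  - by case: (bmfunD (bmfun_cst _ 1) bc).
  - by move=> x; have := sin_geN1 (k%:~R * x : R); lra.
rewrite bmintD//; last exact: bmfun_cst.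
by rewrite bmint_cst => /eqP; rewrite -subr_eq0 addrAC subrr add0r => /eqP.
Qed.

End circle.

Section torus.
Variable R : realType.

Definition tuple_phase n (m : 'I_n -> int)
    (theta : n.-tuple (measurableTypeR R)) : R :=
  \sum_(i < n) (m i)%:~R * tnth theta i.

Lemma measurable_tuple_phase n (m : 'I_n -> int) :
  measurable_fun setT (tuple_phase m).
Proof.
apply: measurable_sum => i; apply: measurable_funM => //.
exact: measurable_tnth.
Qed.

Lemma tuple_phase_cons n (m : 'I_n.+1 -> int) z :
  tuple_phase m (tuple_cons z) =
    (m ord0)%:~R * z.1 + tuple_phase (m \o lift ord0) z.2.
Proof.
rewrite /tuple_phase big_ord_recl; congr (_ + _).
by apply: eq_bigr => i _; rewrite /= tnthS.
Qed.

(** The sine is carried along because the addition formulas, used to separate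
    the first angle from the others, mix it with the cosine. *)
Lemma Rintegral_tuple_phase n (m : 'I_n -> int) :
  \int[tuple_prob (angle_prob R) n]_t cos (tuple_phase m t)
    = [forall i, m i == 0]%:R /\
  \int[tuple_prob (angle_prob R) n]_t sin (tuple_phase m t) = 0.
Proof.
elim: n m => [|n IHn] m.
  have m0 t : tuple_phase m t = 0 by rewrite /tuple_phase big_ord0.
  split; under eq_Rintegral do rewrite m0 ?cos0 ?sin0.
    by rewrite bmint_cst; case: forallP => // -[] [].
  by rewrite bmint_cst.
have [IHc IHs] := IHn (m \o lift ord0).
set Q := tuple_prob _ n in IHc IHs *; set A := angle_prob R.
have bc1 := @bmfun_cos _ _ R _ (measurable_scale (m ord0)%:~R).
have bs1 := @bmfun_sin _ _ R _ (measurable_scale (m ord0)%:~R).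
have bc2 := bmfun_cos (@measurable_tuple_phase _ (m \o lift ord0)).
have bs2 := bmfun_sin (@measurable_tuple_phase _ (m \o lift ord0)).
split; rewrite [tuple_prob _ _]/= bmint_distribution.
- under eq_Rintegral do rewrite tuple_phase_cons cosD.
  rewrite (bmintB _ (bmfun_pair bc1 bc2) (bmfun_pair bs1 bs2)).
  rewrite (bmint_prod A Q bc1 bc2) (bmint_prod A Q bs1 bs2).
  rewrite IHc IHs mulr0 subr0 Rintegral_angle_cos -natrM mulnb.
  congr (nat_of_bool _)%:R.
  apply/andP/forallP => [[m0 /forallP m1] i|mi].
    by have [j ->|->] := unliftP ord0 i; [exact: m1|].
  by split => //; apply/forallP => i; exact: mi.
- exact: bmfun_cos (@measurable_tuple_phase _ m).
- under eq_Rintegral do rewrite tuple_phase_cons sinD.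
  rewrite (bmintD _ (bmfun_pair bs1 bc2) (bmfun_pair bc1 bs2)).
  rewrite (bmint_prod A Q bs1 bc2) (bmint_prod A Q bc1 bs2).
  by rewrite IHs Rintegral_angle_sin mulr0 mul0r addr0.
- exact: bmfun_sin (@measurable_tuple_phase _ m).
Qed.

End torus.

Section phase.
Variables (R : realType) (G : sgraph).
Implicit Types (m p q : {ffun G -> int}) (theta : config R G).

Definition phase m theta : R := \sum_(v : G) (m v)%:~R * angle theta v.

Lemma phase_tuple_phase m theta :
  phase m theta = tuple_phase (fun i => m (enum_val i)) theta.
Proof.
rewrite /phase /tuple_phase (reindex (@enum_val G predT))/=; last first.
  by apply: onW_bij; exact: enum_val_bij.
by apply: eq_bigr => i _; rewrite /angle enum_valK.
Qed.

Lemma measurable_phase m : measurable_fun setT (phase m).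
Proof.
apply: measurable_sum => v; apply: measurable_funM => //.
exact: measurable_angle.
Qed.

Lemma phaseD p q theta : phase (p + q) theta = phase p theta + phase q theta.
Proof.
rewrite /phase -big_split; apply: eq_bigr => v _.
by rewrite ffunE rmorphD mulrDl.
Qed.

Lemma torus_moments m :
  \int[torus_prob R G]_t cos (phase m t) = (m == 0)%:R /\
  \int[torus_prob R G]_t sin (phase m t) = 0.
Proof.
have [Hc Hs] := Rintegral_tuple_phase R (fun i => m (@enum_val G predT i)).
split; under eq_Rintegral do rewrite phase_tuple_phase; last exact: Hs.
rewrite [LHS]Hc; congr (nat_of_bool _)%:R; apply/forallP/eqP => [m0|->] => [|i].
  by apply/ffunP => v; rewrite -(enum_rankK v) (eqP (m0 _)) ffunE.
by rewrite ffunE.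
Qed.

(** The interaction of an edge is itself a character, with frequency
    delta_u - delta_v; this brings the couplings within the scope of Ginibre's
    inequality. *)
Lemma edge_cos_phase (e : edge G) :
  exists m, forall theta, edge_cos e theta = cos (phase m theta).
Proof.
have /cards2P[u [v [_ euv]]] : #|val e| == 2%N.
  by rewrite (edges_card2 (valP e)).
exists [ffun x => (x == u)%:Z - (x == v)%:Z] => theta.
rewrite (edge_cosE theta euv) /phase; congr (cos _).
have D w : angle theta w = \sum_(x : G) (x == w)%:~R * angle theta x.
  rewrite (bigD1 w)//= eqxx mul1r big1 ?addr0// => x /negPf ->.
  by rewrite mul0r.
rewrite (D u) (D v) -sumrB; apply: eq_bigr => x _.
by rewrite ffunE rmorphB mulrBl.
Qed.

Lemma bmfun_edge_cos (e : edge G) : bmfun (edge_cos e : config R G -> R).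
Proof.
by split; [exact: measurable_edge_cos|exists 1 => t; exact: edge_cos_le1].
Qed.

Lemma bmfun_cos_phase m : bmfun (fun t : config R G => cos (phase m t)).
Proof. exact: bmfun_cos (measurable_phase m). Qed.

Lemma bmfun_interaction (J : edge G -> R) : bmfun (interaction J).
Proof.
by apply: bmfun_sum => e; apply: bmfunM (bmfun_edge_cos e); exact: bmfun_cst.
Qed.

(** The Gibbs integral without its normalisation: the correlation functions are
    ratios of two of these, and the covariance inequalities below are stated
    for them after clearing denominators. *)
Definition wint (J : edge G -> R) (f : config R G -> R) : R :=
  \int[torus_prob R G]_t (f t * expR (interaction J t)).

Lemma bmfun_wint (J : edge G -> R) (f : config R G -> R) : bmfun f ->
  bmfun (fun t => f t * expR (interaction J t)).
Proof.
by move=> bf; apply: bmfunM => //; exact/bmfun_expR/bmfun_interaction.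
Qed.

End phase.

(** * Ginibre's inequality *)

(** The argument uses the characters only through their additivity and their
    orthogonality, so it is carried out for an abstract group [L] of
    frequencies acting on a probability space. *)

Section ginibre.
Context d (T : measurableType d) (R : realType) (mu : probability T R).
Variables (L : zmodType) (ph : L -> T -> R).
Hypothesis L_2torsion_free : forall q : L, - q = q -> q = 0.
Hypothesis measurable_ph : forall p, measurable_fun setT (ph p).
Hypothesis phD : forall p q t, ph (p + q) t = ph p t + ph q t.
Hypothesis int_cos_ph : forall p, \int[mu]_t cos (ph p t) = (p == 0)%:R.
Hypothesis int_sin_ph : forall p, \int[mu]_t sin (ph p t) = 0.

Implicit Types (p q m : L) (z : T * T) (f : T * T -> R) (x : L * bool).
Local Notation mu2 := (prod_prob mu mu).

Let ph0 t : ph 0 t = 0.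
Proof. by apply: (addrI (ph 0 t)); rewrite -phD !addr0. Qed.

Let phN p t : ph (- p) t = - ph p t.
Proof. by apply: (addrI (ph p t)); rewrite -phD !subrr. Qed.

Let ph2 p q z := ph p z.1 + ph q z.2.

Lemma measurable_ph2 p q : measurable_fun setT (ph2 p q).
Proof.
apply: measurable_funD.
  exact: measurableT_comp (measurable_ph p) _.
exact: measurableT_comp (measurable_ph q) _.
Qed.

Lemma Rintegral_ph2 p q :
  \int[mu2]_z cos (ph2 p q z) = ((p == 0) && (q == 0))%:R.
Proof.
have bc m := bmfun_cos (measurable_ph m).
have bs m := bmfun_sin (measurable_ph m).
under eq_Rintegral do rewrite cosD.
rewrite (bmintB _ (bmfun_pair (bc p) (bc q)) (bmfun_pair (bs p) (bs q))).
rewrite (bmint_prod _ _ (bc p) (bc q)) (bmint_prod _ _ (bs p) (bs q)).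
by rewrite !int_cos_ph !int_sin_ph mul0r subr0 -natrM mulnb.
Qed.

(** The boolean is the sign of the second term: [false] for +, [true] for -. *)
Definition gfactor x z : R := cos (ph x.1 z.1) + (-1) ^+ x.2 * cos (ph x.1 z.2).

Lemma bmfun_gfactor x : bmfun (gfactor x).
Proof.
apply: bmfunD; first exact: bmfun_comp (bmfun_cos (measurable_ph x.1)).
apply: bmfunM; first exact: bmfun_cst.
exact: bmfun_comp (bmfun_cos (measurable_ph x.1)).
Qed.

(** The sum of the products of chosen signs over the choices of +- m for each
    frequency m of the list that make the total with [p] vanish; choosing - m
    costs the sign attached to m. *)
Fixpoint signed_count (l : seq (L * bool)) p : R :=
  if l is x :: l' then
    signed_count l' (p + x.1) + (-1) ^+ x.2 * signed_count l' (p - x.1)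
  else (p == 0)%:R.

(** Multiplying cos (p . theta + q . theta') by a factor of frequency m moves
    (p, q) to (p +- m, q) and, with the sign of the factor, to (p, q +- m).  In
    the variables s = p + q and t = p - q these are the moves (s +- m, t +- m)
    with equal signs and with opposite signs: the four terms are those of the
    product of [signed_count] at s with [signed_count] at t.  This takes the
    place of the change of variables (theta + theta') / 2,
    (theta - theta') / 2, which is not well defined on the torus. *)
Lemma Rintegral_gfactors (l : seq (L * bool)) p q :
  \int[mu2]_z (cos (ph2 p q z) * \prod_(x <- l) gfactor x z) =
  2^-1 ^+ size l * (signed_count l (p + q) * signed_count l (p - q)).
Proof.
elim: l p q => [|[m b] l IHl] p q /=.
  under eq_Rintegral do rewrite big_nil mulr1.
  rewrite Rintegral_ph2 expr0 mul1r -natrM mulnb; congr (nat_of_bool _)%:R.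
  rewrite addr_eq0 subr_eq0; apply/andP/andP => -[/eqP pq /eqP qp].
    by rewrite pq qp oppr0.
  move: pq; rewrite qp => /eqP; rewrite eq_sym => /eqP qq.
  suff -> : q = 0 by [].
  exact: L_2torsion_free.
pose C p' q' z := cos (ph2 p' q' z) * \prod_(x <- l) gfactor x z.
have bC p' q' : bmfun (C p' q').
  apply: bmfunM; first exact: bmfun_cos (measurable_ph2 p' q').
  by apply: bmfun_prod => x; exact: bmfun_gfactor.
have -> : \int[mu2]_z (cos (ph2 p q z) * \prod_(x <- (m, b) :: l) gfactor x z)
  = \int[mu2]_z (2^-1 * (C (p + m) q z + C (p - m) q z +
       (-1) ^+ b * (C p (q + m) z + C p (q - m) z))).
  apply: eq_Rintegral => z _; rewrite big_cons /C /ph2 /gfactor /=.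
  rewrite !phD !phN.
  set P := ph p _; set Q := ph q _; set X := ph m z.1; set Y := ph m z.2.
  rewrite (_ : P + X + Q = (P + Q) + X); last by ring.
  rewrite (_ : P - X + Q = (P + Q) - X); last by ring.
  rewrite !addrA -[P + Q - Y]/((P + Q) - Y).
  by rewrite !cosD !cosN !sinN; field.
have bD p1 q1 p2 q2 : bmfun (fun z => C p1 q1 z + C p2 q2 z) by exact: bmfunD.
have bZ (c : R) f : bmfun f -> bmfun (fun z => c * f z).
  by apply: bmfunM; exact: bmfun_cst.
rewrite bmintZ; last by apply: bmfunD; [exact: bD|exact/bZ/bD].
rewrite bmintD; [|exact: bD|exact/bZ/bD].
rewrite bmintZ; last exact: bD.
rewrite !bmintD; do ?exact: bC.
rewrite !IHl exprS.
rewrite (_ : p + m + q = p + q + m); last by rewrite addrAC.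
rewrite (_ : p + m - q = p - q + m); last by rewrite addrAC.
rewrite (_ : p - m + q = p + q - m); last by rewrite addrAC.
rewrite (_ : p - m - q = p - q - m); last by rewrite addrAC.
rewrite (_ : p + (q + m) = p + q + m); last by rewrite addrA.
rewrite (_ : p + (q - m) = p + q - m); last by rewrite addrA.
rewrite (_ : p - (q + m) = p - q - m); last by rewrite opprD addrA.
rewrite (_ : p - (q - m) = p - q + m); last by rewrite opprB addrA addrAC.
by case: b; rewrite ?expr1 ?expr0; ring.
Qed.

(** The cone of functions of two replicas to which the doubled Gibbs weight
    belongs; testing against all products of factors makes it stable under
    multiplication by a factor. *)
Definition gpositive f := bmfun f /\
  forall l, 0 <= \int[mu2]_z (f z * \prod_(x <- l) gfactor x z).

Lemma gpositive1 : gpositive (fun=> 1).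
Proof.
split=> [|l]; first exact: bmfun_cst.
have := Rintegral_gfactors l 0 0; rewrite addr0 subr0 -expr2.
under eq_Rintegral do rewrite /ph2 !ph0 addr0 cos0.
by move=> ->; rewrite mulr_ge0 ?sqr_ge0// exprn_ge0// invr_ge0.
Qed.

Lemma gpositive_gfactor f x : gpositive f ->
  gpositive (fun z => f z * gfactor x z).
Proof.
move=> [bf f0]; split; first by apply: bmfunM => //; exact: bmfun_gfactor.
move=> l; have := f0 (x :: l).
by under eq_Rintegral do rewrite big_cons mulrA.
Qed.

Let bmfun_gfactors f l : bmfun f ->
  bmfun (fun z => f z * \prod_(x <- l) gfactor x z).
Proof.
by move=> bf; apply: bmfunM => //; apply: bmfun_prod => x; exact: bmfun_gfactor.
Qed.

Lemma gpositiveZ f (c : R) : 0 <= c -> gpositive f ->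
  gpositive (fun z => c * f z).
Proof.
move=> c0 [bf f0]; split; first by apply: bmfunM bf; exact: bmfun_cst.
move=> l; under eq_Rintegral do rewrite -mulrA.
by rewrite (bmintZ _ _ (bmfun_gfactors l bf)) mulr_ge0.
Qed.

Lemma gpositive_sum (I : Type) (s : seq I) (F : I -> T * T -> R) :
  (forall i, gpositive (F i)) -> gpositive (fun z => \sum_(i <- s) F i z).
Proof.
move=> F0; split; first by apply: bmfun_sum => i; have [] := F0 i.
move=> l; under eq_Rintegral do rewrite mulr_suml.
rewrite bmint_sum; last by move=> i; apply: bmfun_gfactors; have [] := F0 i.
by apply: sumr_ge0 => i _; have [_] := F0 i; exact.
Qed.

(** Dominated convergence; needed to pass from the Taylor polynomials of the
    exponential to the exponential. *)
Lemma gpositive_cvg (F : nat -> T * T -> R) f (M : R) :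
  (forall n, gpositive (F n)) -> bmfun f -> (forall n z, `|F n z| <= M) ->
  (forall z, F n z @[n --> \oo] --> f z) -> gpositive f.
Proof.
move=> F0 bf FM Ff; split=> // l.
set g := fun z => \prod_(x <- l) gfactor x z.
have [_ [N gN]] : bmfun g by apply: bmfun_prod => x; exact: bmfun_gfactor.
have : \int[mu2]_z (F n z * g z) @[n --> \oo] --> \int[mu2]_z (f z * g z).
  apply: (@bmint_cvg _ _ _ _ _ _ (M * N)).
  - by move=> n; apply: bmfun_gfactors; have [] := F0 n.
  - exact: bmfun_gfactors.
  - by move=> n z; rewrite normrM ler_pM.
  - by move=> z; apply: cvgMl; exact: Ff.
move=> /[dup] /cvg_lim <-//; move=> /cvgP cF; apply: limr_ge => //.
by apply: nearW => n; have [_] := F0 n; exact.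
Qed.

Lemma gpositive_expR (W : T * T -> R) : bmfun W ->
  (forall f, gpositive f -> gpositive (fun z => f z * W z)) ->
  gpositive (fun z => expR (W z)).
Proof.
move=> bW W0; have [_ [M WM]] := bW.
pose F n z := series (exp_coeff (W z)) n.
apply: (@gpositive_cvg F _ (expR M)).
- move=> n; rewrite /F /series /=; apply: gpositive_sum => k.
  rewrite /exp_coeff /=.
  suff H : gpositive (fun z => W z ^+ k).
    under eq_fun do rewrite mulrC.
    by apply: (gpositiveZ _ H); rewrite invr_ge0.
  elim: k => [|k IHk].
    by under eq_fun do rewrite expr0; exact: gpositive1.
  by under eq_fun do rewrite exprSr; exact: W0.
- exact: bmfun_expR.
- move=> n z; rewrite /F /series /=.
  apply: (le_trans (ler_norm_sum _ _ _)).
  apply: (@le_trans _ _ (series (exp_coeff `|W z|) n)).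
    rewrite /series /= ler_sum// => k _; rewrite /exp_coeff /= normrM normrX.
    by rewrite ler_wpM2l// ger0_norm// invr_ge0.
  apply: (@le_trans _ _ (expR `|W z|)); last by rewrite ler_expR.
  apply: nondecreasing_cvgn_le; last exact: is_cvg_series_exp_coeff.
  by apply: nondecreasing_series => k _ _; exact: exp_coeff_ge0.
- by move=> z; exact: is_cvg_series_exp_coeff.
Qed.

(** The doubled energy is a nonnegative combination of factors with sign +, so
    its exponential is [gpositive]; testing it on the two factors with sign -
    of frequencies p and q gives twice the claimed difference. *)
Lemma ginibre_inequality (I : finType) (c : I -> L) (J : I -> R) p q
    (E := fun t => expR (\sum_i J i * cos (ph (c i) t))) :
  (forall i, 0 <= J i) ->
  (\int[mu]_t (cos (ph p t) * E t)) * (\int[mu]_t (cos (ph q t) * E t)) <=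
  (\int[mu]_t (cos (ph p t) * cos (ph q t) * E t)) * (\int[mu]_t (1 * E t)).
Proof.
move=> J0; pose H t := \sum_i J i * cos (ph (c i) t).
pose W z := H z.1 + H z.2.
have bcos m : bmfun (fun t => cos (ph m t)) by exact: bmfun_cos.
have bH : bmfun H.
  by apply: bmfun_sum => i; apply: bmfunM => //; exact: bmfun_cst.
have bW : bmfun W.
  apply: bmfunD; first exact: bmfun_comp bH.
  exact: bmfun_comp bH.
have [_ /(_ [:: (p, true); (q, true)])] : gpositive (fun z => expR (W z)).
  apply: gpositive_expR => // f f0.
  have -> : (fun z => f z * W z) =
      (fun z => \sum_i J i * (f z * gfactor (c i, false) z)).
    apply/funext => z; rewrite /W /H /gfactor -big_split/= mulr_sumr.
    by apply: eq_bigr => i _; rewrite expr0; ring.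
  apply: gpositive_sum => i; apply: gpositiveZ => //.
  exact: gpositive_gfactor.
pose A t : R := cos (ph p t); pose B t : R := cos (ph q t).
have -> : \int[mu2]_z (expR (W z) *
      \prod_(x <- [:: (p, true); (q, true)]) gfactor x z) =
    \int[mu2]_z (((A z.1 * B z.1 * E z.1) * (1 * E z.2) +
                  (1 * E z.1) * (A z.2 * B z.2 * E z.2)) -
      ((A z.1 * E z.1) * (B z.2 * E z.2) + (B z.1 * E z.1) * (A z.2 * E z.2))).
  apply: eq_Rintegral => z _; rewrite !big_cons big_nil /gfactor /= expRD expr1.
  by rewrite -/(A _) -/(A _) -/(B _) -/(B _) -/(E _) -/(E _); ring.
have bE : bmfun E := bmfun_expR bH.
have bAE := bmfunM (bcos p) bE; have bBE := bmfunM (bcos q) bE.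
have bABE := bmfunM (bmfunM (bcos p) (bcos q)) bE.
have b1E := bmfunM (bmfun_cst _ 1) bE.
rewrite (bmintB _ (bmfunD (bmfun_pair bABE b1E) (bmfun_pair b1E bABE))
                  (bmfunD (bmfun_pair bAE bBE) (bmfun_pair bBE bAE))).
rewrite (bmintD _ (bmfun_pair bABE b1E) (bmfun_pair b1E bABE)).
rewrite (bmintD _ (bmfun_pair bAE bBE) (bmfun_pair bBE bAE)).
rewrite (bmint_prod _ _ bABE b1E) (bmint_prod _ _ b1E bABE).
rewrite (bmint_prod _ _ bAE bBE) (bmint_prod _ _ bBE bAE).
rewrite /A /B; lra.
Qed.

End ginibre.

(** The lattice of integer vectors has no 2-torsion, so the abstract inequality
    applies to the torus. *)
Lemma wint_ginibre (R : realType) (G : sgraph) (J : edge G -> R)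
    (p q : {ffun G -> int}) : (forall e, 0 <= J e) ->
  wint J (fun t => cos (phase p t)) * wint J (fun t => cos (phase q t)) <=
  wint J (fun t => cos (phase p t) * cos (phase q t)) * wint J (fun=> 1).
Proof.
move=> J0.
have [c ec] : exists c : edge G -> {ffun G -> int},
    forall e theta, edge_cos e theta = cos (phase (c e) theta) :> R.
  by case: (boolp.choice (@edge_cos_phase R G)) => c Hc; exists c.
have HE : interaction J = (fun t => \sum_e J e * cos (phase (c e) t)).
  by apply/funext => t; apply: eq_bigr => e _; rewrite ec.
rewrite /wint HE.
apply: (@ginibre_inequality _ _ _ (torus_prob R G) _ (@phase R G)) => //.
- move=> {}q qq; apply/ffunP => v; move/ffunP/(_ v): qq; rewrite !ffunE => qv.
  apply/eqP; have : q v *+ 2 == 0 by rewrite mulr2n -{1}qv addNr.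
  by rewrite mulrn_eq0.
- exact: measurable_phase.
- exact: phaseD.
- by move=> m; have [] := torus_moments R m.
- by move=> m; have [] := torus_moments R m.
Qed.

(** * Convexity of a tilted mean in the variable e^(-2t) *)

Section tilted_integrals.
Context d (T : measurableType d) (R : realType) (mu : probability T R).
Variables (h X : T -> R).
Hypotheses (bh : bmfun h) (bX : bmfun X).
Implicit Types f : T -> R.

Definition tilt f (t : R) : R := \int[mu]_x (f x * expR (h x + t * X x)).

Lemma bmfun_tilt f t : bmfun f -> bmfun (fun x => f x * expR (h x + t * X x)).
Proof.
move=> bf; apply: bmfunM => //; apply/bmfun_expR/bmfunD => //.
by apply: bmfunM => //; exact: bmfun_cst.
Qed.

Lemma is_derive_tilt f (t : R) : bmfun f ->
  is_derive t (1 : R) (tilt f) (tilt (fun x => f x * X x) t).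
Proof.
move=> bf.
pose F (s : R) x := f x * expR (h x + s * X x).
have [_ [Mf fM]] := bf; have [_ [Mh hM]] := bh; have [_ [MX XM]] := bX.
have dF (s : R) x :
    is_derive s (1 : R) (F ^~ x) (f x * X x * expR (h x + s * X x)).
  by apply: is_derive_eq; rewrite /GRing.scale/=; ring.
have I0 : `]t - 1, t + 1[%classic t.
  by rewrite /= in_itv /= ltrBlDr ltrDl ltr01.
have intF s : `]t - 1, t + 1[%classic s -> mu.-integrable setT (EFin \o F s).
  by move=> _; exact/bmfun_integrable/bmfun_tilt.
have derF s x : `]t - 1, t + 1[%classic s -> setT x -> derivable (F ^~ x) s 1.
  by move=> _ _; have [] := dF s x.
(* A bound on the derivative of the integrand, uniform for |s - t| < 1. *)
pose M := `|Mf| * `|MX| * expR (Mh + (`|t| + 1) * `|MX|).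
have M0 : 0 <= M by rewrite /M !mulr_ge0 ?expR_ge0.
have domF s x : `]t - 1, t + 1[%classic s -> setT x ->
    `|partial1of2 F s x| <= M.
  rewrite /= in_itv /= => /andP[ts st] _.
  rewrite partial1of2E; have [_ ->] := dF s x.
  have {}fM : `|f x| <= `|Mf| := le_trans (fM x) (ler_norm _).
  have {}XM : `|X x| <= `|MX| := le_trans (XM x) (ler_norm _).
  rewrite /M !normrM ler_pM ?mulr_ge0//; first by rewrite ler_pM.
  rewrite ger0_norm ?expR_ge0// ler_expR lerD//.
    exact: le_trans (ler_norm _) (hM x).
  apply: (le_trans (ler_norm _)); rewrite normrM ler_pM//.
  rewrite ler_norml; have := ler_norm t; have := ler_norm (- t); rewrite normrN.
  by move=> h1 h2; apply/andP; split; lra.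
have intM : mu.-integrable setT (EFin \o (fun _ : T => M)).
  exact/bmfun_integrable/bmfun_cst.
apply: DeriveDef.
  exact: (derivable_under_integral measurableT I0 intF derF (fun=> M0) intM).
rewrite -derive1E.
rewrite (differentiation_under_integral measurableT I0 intF derF _ intM domF)//.
apply: eq_Rintegral => x _ /=.
by rewrite partial1of2E; have [_ ->] := dF t x.
Qed.

Lemma tilt1_gt0 t : 0 < tilt (fun=> 1) t.
Proof.
apply: bmint_gt0 => [|x]; first by apply: bmfun_tilt; exact: bmfun_cst.
by rewrite mul1r expR_gt0.
Qed.

End tilted_integrals.

Lemma mean_value (R : realType) (f df : R -> R) (a b : R) :
  (forall x : R, is_derive x (1 : R) f (df x)) -> a <= b ->
  exists2 c, a <= c <= b & f b - f a = df c * (b - a).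
Proof.
move=> fdf ab.
have cf : {within `[a, b], continuous f}.
  apply: continuous_subspaceT => x; apply: differentiable_continuous.
  by apply/derivable1_diffP; have [] := fdf x.
have [c cab ->] := MVT_segment ab (fun x _ => fdf x) cf.
by exists c => //; move: cab; rewrite in_itv.
Qed.

(** The mean of [A] under the weight e^(h + t X) is a convex function of
    e^(-2t), for t >= 0, as soon as X is at most 1 and A is nonnegatively
    correlated with X and with X^2. *)

Section support_inequality.
Context d (T : measurableType d) (R : realType) (mu : probability T R).
Variables (h X A : T -> R).
Hypotheses (bh : bmfun h) (bX : bmfun X) (bA : bmfun A).
Hypothesis X_le1 : forall x, X x <= 1.
Local Notation tilt := (tilt mu h X).
Hypothesis cov_A_X : forall t, 0 <= t ->
  tilt A t * tilt X t <= tilt (fun x => A x * X x) t * tilt (fun=> 1) t.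
Hypothesis cov_A_X2 : forall t, 0 <= t ->
  tilt A t * tilt (fun x => X x ^+ 2) t
    <= tilt (fun x => A x * X x ^+ 2) t * tilt (fun=> 1) t.

Let Z := tilt (fun=> 1).
Let D t := tilt (fun x => A x * X x) t * Z t - tilt A t * tilt X t.

Let bAX : bmfun (fun x => A x * X x). Proof. exact: bmfunM. Qed.
Let b1 : bmfun (fun x : T => 1 : R). Proof. exact: bmfun_cst. Qed.

Let Z_neq0 t : Z t != 0.
Proof. by rewrite gt_eqF// tilt1_gt0. Qed.

Let dA (t : R) : is_derive t (1 : R) (tilt A) (tilt (fun x => A x * X x) t).
Proof. exact: is_derive_tilt. Qed.

Let dZ (t : R) : is_derive t (1 : R) Z (tilt X t).
Proof.
apply: is_derive_eq; first exact: is_derive_tilt.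
by congr Rintegral; apply/funext => x; rewrite mul1r.
Qed.

Let dX (t : R) : is_derive t (1 : R) (tilt X) (tilt (fun x => X x ^+ 2) t).
Proof. exact: is_derive_tilt. Qed.

Let dAX (t : R) : is_derive t (1 : R) (tilt (fun x => A x * X x))
  (tilt (fun x => A x * X x ^+ 2) t).
Proof.
apply: is_derive_eq; first exact: is_derive_tilt.
by congr Rintegral; apply/funext => x; rewrite expr2 mulrA.
Qed.

Let dD (t : R) : is_derive t (1 : R) D
  (tilt (fun x => A x * X x ^+ 2) t * Z t -
    tilt A t * tilt (fun x => X x ^+ 2) t).
Proof.
have := dA t; have := dZ t; have := dX t; have := dAX t => ? ? ? ?.
by apply: is_derive_eq; rewrite /GRing.scale/=; ring.
Qed.

Let dZV (t : R) :
  is_derive t (1 : R) (fun s => (Z s)^-1) (- tilt X t / Z t ^+ 2).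
Proof.
have [dZt eZ] := dZ t; apply: DeriveDef; first exact: derivableV.
by rewrite deriveV// eZ /GRing.scale/= !mulNr mulrC.
Qed.

(** Minus the derivative of the tilted mean of [A] with respect to e^(-2t). *)
Definition slope (t : R) : R :=
  2^-1 * expR (2 * t) * (D t * (Z t)^-1 * (Z t)^-1).

Let dslope (t : R) : is_derive t (1 : R) slope
  (2^-1 * expR (2 * t) * (Z t)^-1 ^+ 3 *
    (2 * D t * (Z t - tilt X t) + Z t * (tilt (fun x => A x * X x ^+ 2) t * Z t
        - tilt A t * tilt (fun x => X x ^+ 2) t))).
Proof.
have := dD t; have := dZV t => ? ?.
apply: is_derive_eq; rewrite /GRing.scale/=.
field; exact: Z_neq0.
Qed.

Let dratio (t : R) : is_derive t (1 : R) (fun s => tilt A s * (Z s)^-1)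
  (D t * (Z t)^-1 * (Z t)^-1).
Proof.
have := dA t; have := dZV t => ? ?.
apply: is_derive_eq; rewrite /GRing.scale/= /D.
field; exact: Z_neq0.
Qed.

(** The derivative of the slope is a positive multiple of
    2 D (Z - Z') + Z D'.  Here D and D' are Z^2 times the covariances of A with
    X and with X^2, and Z' is at most Z because X is at most 1. *)
Lemma slope_nondecreasing s t : 0 <= s -> s <= t -> slope s <= slope t.
Proof.
move=> s0 st; have [c /andP[sc ct] E] := mean_value dslope st.
rewrite -subr_ge0 E mulr_ge0 ?subr_ge0//.
have c0 : 0 <= c := le_trans s0 sc.
have Z0 : 0 < Z c := tilt1_gt0 mu bh bX c.
rewrite !mulr_ge0 ?expR_ge0 ?exprn_ge0 ?invr_ge0 ?(ltW Z0)// addr_ge0//.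
- rewrite !mulr_ge0// ?subr_ge0; first exact: cov_A_X.
  apply: bmint_le; [exact: bmfun_tilt|exact: bmfun_tilt|] => x.
  by rewrite ler_wpM2r ?expR_ge0.
- by rewrite mulr_ge0 ?(ltW Z0)// subr_ge0; exact: cov_A_X2.
Qed.

(** The tangent inequality of a convex function, obtained by applying the mean
    value theorem to the difference between the function and its tangent, whose
    derivative has the sign of the increment of the slope. *)
Lemma support_inequality s t : 0 <= s -> 0 <= t ->
  slope s * (expR (- (2 * s)) - expR (- (2 * t))) <=
    tilt A t / Z t - tilt A s / Z s.
Proof.
move=> s0 t0.
pose phi u := tilt A u * (Z u)^-1 + slope s * expR (- (2 * u)).
have dphi (u : R) : is_derive u (1 : R) phi
    (2 * expR (- (2 * u)) * (slope u - slope s)).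
  have := dratio u => ?; apply: is_derive_eq; rewrite /GRing.scale/=.
  have -> : slope u = 2^-1 * expR (2 * u) * (D u * (Z u)^-1 * (Z u)^-1) by [].
  set r := D u * _ * _.
  transitivity (expR (- (2 * u)) * expR (2 * u) * r
    - 2 * expR (- (2 * u)) * slope s); last by field.
  by rewrite -expRD addNr expR0; ring.
(* phi is minimal at s: its derivative changes sign there. *)
suff : phi s <= phi t by rewrite /phi mulrBr lerBlDr addrAC lerBrDl.
have [st|ts] := leP s t.
  have [c /andP[sc ct] E] := mean_value dphi st.
  rewrite -subr_ge0 E !mulr_ge0 ?expR_ge0 ?subr_ge0//.
  exact: slope_nondecreasing.
have [c /andP[tc cs] E] := mean_value dphi (ltW ts).
rewrite -subr_le0 E mulr_le0_ge0 ?subr_ge0 ?(ltW ts)//.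
rewrite mulr_ge0_le0 ?mulr_ge0 ?expR_ge0//.
by rewrite subr_le0; apply: slope_nondecreasing => //; exact: le_trans tc.
Qed.

End support_inequality.

(** * Dependence of the correlation on one coupling *)

(** By uniqueness, p is almost everywhere the Radon-Nikodym derivative of nu,
    to which the change of variables formula applies. *)
Lemma Rintegral_density d (T : measurableType d) (R : realType)
    (mu nu : probability T R) (p f : T -> R) :
  bmfun p -> (forall A, measurable A -> nu A = \int[mu]_(x in A) (p x)%:E)%E ->
  bmfun f -> \int[nu]_x f x = \int[mu]_x (f x * p x).
Proof.
move=> bp nuE bf; congr fine.
have mp : measurable_fun setT (EFin \o p) by apply/measurable_EFinP; case: bp.
have mf : measurable_fun setT (EFin \o f) by apply/measurable_EFinP; case: bf.
have numu : nu `<< mu.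
  apply/null_content_dominatesP => A mA muA0.
  by rewrite nuE// null_set_integral//; exact: measurable_funTS.
rewrite -(@Radon_Nikodym_change_of_variables _ _ _ nu mu)//; last first.
  exact: bmfun_integrable.
apply: ae_eq_integral => //.
- by apply: emeasurable_funM => //; exact: measurable_funPT.
- by apply/measurable_EFinP/measurable_funM; apply/measurable_EFinP.
apply: (@ae_eqe_mul2l _ _ _ _ _ _ (EFin \o p) (EFin \o f)).
apply: integral_ae_eq => //; first exact: Radon_Nikodym_integrable.
by move=> A _ mA; rewrite -Radon_Nikodym_integral//= nuE.
Qed.

Section correlation.
Variables (R : realType) (G : sgraph).
Implicit Types (J : edge G -> R) (a : G -> int).

Lemma bmfun_gibbs_pdf J : bmfun (gibbs_pdf J).
Proof.
apply: bmfunM; first exact: bmfun_cst.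
exact/bmfun_expR/bmfun_interaction.
Qed.

Lemma xy_correlationE a J :
  xy_correlation a J =
    wint J (fun t => cos (phase (finfun a) t)) / wint J (fun=> 1).
Proof.
rewrite /xy_correlation.
have -> : (fun t : config R G => cos (\sum_(v : G) (a v)%:~R * angle t v)) =
    (fun t => cos (phase (finfun a) t)).
  apply/funext => t; congr (cos _); apply: eq_bigr => v _.
  by rewrite ffunE.
have bc := bmfun_cos_phase R (finfun a).
rewrite (@Rintegral_density _ _ _ (torus_prob R G) _ (gibbs_pdf J))//;
  last exact: bmfun_gibbs_pdf.
rewrite /gibbs_pdf; have -> : partition_function J = wint J (fun=> 1).
  by apply: eq_Rintegral => t _; rewrite mul1r.
rewrite [RHS]mulrC -bmintZ; last exact: bmfun_wint.
by apply: eq_Rintegral => t _; rewrite mulrCA.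
Qed.

End correlation.

Section single_edge.
Variables (R : realType) (G : sgraph).
Implicit Types (J : edge G -> R) (a : G -> int) (e : edge G).
Implicit Types f : config R G -> R.

Definition set_coupling J e (t : R) : edge G -> R :=
  fun e' => if e' == e then t else J e'.

Lemma set_coupling_ge0 J e t : (forall e', 0 <= J e') -> 0 <= t ->
  forall e', 0 <= set_coupling J e t e'.
Proof. by move=> J0 t0 e'; rewrite /set_coupling; case: ifP. Qed.

Lemma set_coupling_id J e : set_coupling J e (J e) = J.
Proof. by apply/funext => e'; rewrite /set_coupling; case: eqP => // ->. Qed.

Lemma interaction_set_coupling J e t theta :
  interaction (set_coupling J e t) theta =
    interaction (set_coupling J e 0) theta + t * edge_cos e theta.
Proof.
rewrite /interaction (bigD1 e)//= [in RHS](bigD1 e)//= /set_coupling eqxx.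
rewrite mul0r add0r addrC.
by congr (_ + _); apply: eq_bigr => e' /negPf ->.
Qed.

Lemma wint_set_coupling J e t f :
  wint (set_coupling J e t) f =
    tilt (torus_prob R G) (interaction (set_coupling J e 0)) (edge_cos e) f t.
Proof. by apply: eq_Rintegral => theta _; rewrite interaction_set_coupling. Qed.

(** The square of a character cosine is again a combination of character
    cosines, 1/2 + cos (2m . theta) / 2. *)
Lemma wint_ginibre_sqr J (p m : {ffun G -> int}) : (forall e, 0 <= J e) ->
  wint J (fun t => cos (phase p t)) * wint J (fun t => cos (phase m t) ^+ 2) <=
  wint J (fun t => cos (phase p t) * cos (phase m t) ^+ 2) * wint J (fun=> 1).
Proof.
move=> J0.
pose A t : R := cos (phase p t); pose C t : R := cos (phase (m + m) t).
have sqrE t : cos (phase m t) ^+ 2 = 2^-1 * (1 + C t).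
  by rewrite /C phaseD cosD -!expr2 sin2cos2; field.
have bA : bmfun A := bmfun_cos_phase R p.
have bC : bmfun C := bmfun_cos_phase R (m + m).
have -> : wint J (fun t => cos (phase m t) ^+ 2) =
    2^-1 * (wint J (fun=> 1) + wint J C).
  have bC' := bmfun_wint J bC; have b1 := bmfun_wint J (bmfun_cst _ 1).
  rewrite /wint -bmintD// -bmintZ; last exact: bmfunD.
  by apply: eq_Rintegral => t _; rewrite sqrE; ring.
have -> : wint J (fun t => cos (phase p t) * cos (phase m t) ^+ 2) =
    2^-1 * (wint J A + wint J (fun t => A t * C t)).
  have bA' := bmfun_wint J bA; have bAC := bmfun_wint J (bmfunM bA bC).
  rewrite /wint -bmintD// -bmintZ; last exact: bmfunD.
  by apply: eq_Rintegral => t _; rewrite sqrE -/(A t); ring.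
have := wint_ginibre p (m + m) J0; rewrite -/A -/C => AC.
rewrite mulrCA -mulrA ler_pM2l ?invr_gt0// mulrDr mulrDl.
by rewrite lerD2l.
Qed.

(** [slope] for the edge e, written through [wint] so that its measurability in
    J can be read off. *)
Definition edge_slope a e J : R :=
  let A theta := cos (phase (finfun a) theta) in
  2^-1 * expR (2 * J e) *
    ((wint J (fun t => A t * edge_cos e t) * wint J (fun=> 1) -
      wint J A * wint J (edge_cos e)) *
      (wint J (fun=> 1))^-1 * (wint J (fun=> 1))^-1).

Lemma xy_correlation_support a e J t : (forall e', 0 <= J e') -> 0 <= t ->
  edge_slope a e J * (expR (- (2 * J e)) - expR (- (2 * t))) <=
    xy_correlation a (set_coupling J e t) - xy_correlation a J.
Proof.
move=> J0 t0; pose A theta : R := cos (phase (finfun a) theta).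
have [m em] := edge_cos_phase R e.
have Xm : edge_cos e = fun theta : config R G => cos (phase m theta).
  exact/funext.
have H f : wint J f = tilt (torus_prob R G)
    (interaction (set_coupling J e 0)) (edge_cos e) f (J e).
  by rewrite -wint_set_coupling set_coupling_id.
rewrite !xy_correlationE /edge_slope !H !wint_set_coupling.
apply: (@support_inequality _ _ _ (torus_prob R G)) => //.
- exact: bmfun_interaction.
- exact: bmfun_edge_cos.
- exact: bmfun_cos_phase.
- by move=> theta; have := edge_cos_le1 e theta; rewrite ler_norml => /andP[].
- move=> s s0; rewrite -!wint_set_coupling Xm.
  exact/wint_ginibre/set_coupling_ge0.
- move=> s s0; rewrite -!wint_set_coupling Xm.
  exact/wint_ginibre_sqr/set_coupling_ge0.
Qed.

End single_edge.

(** * Independence and measurability in the couplings *)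

Section independence.
Context d (T : measurableType d) (R : realType) (P : probability T R).

(** The product rule on rectangles identifies the joint law of X and Y with the
    product of their laws, and Fubini does the rest.  The target of X is left
    arbitrary because X will be the identity towards a smaller sigma-algebra. *)
Lemma bmint_indep d1 d2 (T1 : measurableType d1) (T2 : measurableType d2)
    (X : T -> T1) (Y : T -> T2) (f : T1 -> R) (g : T2 -> R) :
  measurable_fun setT X -> measurable_fun setT Y -> bmfun f -> bmfun g ->
  (forall U V, measurable U -> measurable V ->
    P (X @^-1` U `&` Y @^-1` V) = P (X @^-1` U) * P (Y @^-1` V))%E ->
  \int[P]_w (f (X w) * g (Y w)) = (\int[P]_w f (X w)) * (\int[P]_w g (Y w)).
Proof.
move=> mX mY bf bg XY.
have mXY : measurable_fun setT (fun w => (X w, Y w)).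
  exact: measurable_fun_pair.
pose X' : {mfun T >-> T1} := HB.pack X (isMeasurableFun.Build _ _ _ _ X mX).
pose Y' : {mfun T >-> T2} := HB.pack Y (isMeasurableFun.Build _ _ _ _ Y mY).
pose XY' : {mfun T >-> (T1 * T2)%type} := HB.pack (fun w => (X w, Y w))
  (isMeasurableFun.Build _ _ _ _ (fun w => (X w, Y w)) mXY).
have bfg := bmfun_pair bf bg.
rewrite -(bmint_distribution P X' bf) -(bmint_distribution P Y' bg).
rewrite -(bmint_prod _ _ bf bg) -(bmint_distribution P XY' bfg).
congr fine; apply: eq_measure_integral => A mA _; symmetry.
by apply: product_measure_unique => // U V mU mV; rewrite -XY.
Qed.

End independence.

Section parametric_measurability.
Context d (S : measurableType d) (R : realType) (G : sgraph).
Variable j : S -> edge G -> R.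
Hypothesis mj : forall e, measurable_fun setT (j ^~ e).
Implicit Types f : config R G -> R.

Let measurable_wint_ge0 f : bmfun f -> (forall t, 0 <= f t) ->
  measurable_fun setT (fun s => wint (j s) f).
Proof.
move=> bf f0; apply: measurableT_comp => //.
pose F (z : S * config R G) := ((f z.2 * expR (interaction (j z.1) z.2))%:E)%E.
apply: (@measurable_fun_fubini_tonelli_F _ _ S (config R G) R _ F); last first.
  by move=> z; rewrite /F lee_fin mulr_ge0// expR_ge0.
apply/measurable_EFinP; apply: measurable_funM.
  by case: bf => mf _; exact: (measurableT_comp mf measurable_snd).
apply: measurableT_comp => //; apply: measurable_sum => e.
apply: measurable_funM; first exact: (measurableT_comp (mj e) measurable_fst).
exact: (measurableT_comp (measurable_edge_cos e) measurable_snd).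
Qed.

(** Tonelli's theorem gives the measurability for nonnegative f; a bounded f is
    a difference of two such functions. *)
Lemma measurable_wint f : bmfun f ->
  measurable_fun setT (fun s => wint (j s) f).
Proof.
move=> bf; have [_ [M fM]] := bf.
have bM : bmfun (fun _ : config R G => `|M|) by exact: bmfun_cst.
have -> : (fun s => wint (j s) f) =
    (fun s => wint (j s) (fun t => f t + `|M|) - wint (j s) (fun=> `|M|)).
  apply/funext => s; rewrite /wint -bmintB; last exact: bmfun_wint.
    by apply: eq_Rintegral => t _; ring.
  exact/bmfun_wint/bmfunD.
apply: measurable_funB; apply: measurable_wint_ge0 => //; first exact: bmfunD.
move=> t; have := ler_norm M; have := fM t.
by rewrite ler_norml => /andP[]; lra.
Qed.

End parametric_measurability.

Section bounded_correlation.
Variables (R : realType) (G : sgraph).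
Implicit Types (J : edge G -> R) (a : G -> int) (e : edge G).

Lemma wint1_gt0 J : 0 < wint J (fun=> 1).
Proof.
rewrite /wint; under eq_Rintegral do rewrite mul1r.
apply: bmint_gt0 => [|t]; last exact: expR_gt0.
exact/bmfun_expR/bmfun_interaction.
Qed.

Lemma norm_wint_le J (f : config R G -> R) :
  bmfun f -> (forall t, `|f t| <= 1) ->
  `|wint J f / wint J (fun=> 1)| <= 1.
Proof.
move=> bf f1; have Z0 := wint1_gt0 J.
have b1 := bmfun_wint J (bmfun_cst _ 1).
rewrite normrM normfV (gtr0_norm Z0) ler_pdivrMr// mul1r ler_norml.
apply/andP; split; last first.
  apply: bmint_le => //; first exact: bmfun_wint.
  move=> t; rewrite ler_wpM2r ?expR_ge0//.
  exact: le_trans (ler_norm _) (f1 t).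
rewrite lerNl -mulN1r /wint -bmintZ; last exact: bmfun_wint.
apply: bmint_le => //.
  by apply: bmfunM; [exact: bmfun_cst|exact: bmfun_wint].
move=> t; rewrite mulrA mulN1r ler_wpM2r ?expR_ge0//.
by apply: (le_trans (ler_norm _)); rewrite normrN.
Qed.

Context d (S : measurableType d) (j : S -> edge G -> R).
Hypothesis mj : forall e, measurable_fun setT (j ^~ e).

Lemma bmfun_wint_ratio (f : config R G -> R) :
  bmfun f -> (forall t, `|f t| <= 1) ->
  bmfun (fun s => wint (j s) f / wint (j s) (fun=> 1)).
Proof.
move=> bf f1; split; last by exists 1 => s; exact: norm_wint_le.
apply: measurable_funM; first exact: measurable_wint.
have m1 : measurable_fun setT (fun s => wint (j s) (fun=> 1)).
  by apply: measurable_wint => //; exact: bmfun_cst.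
(* Measurability of the inverse is inherited from that of the logarithm. *)
have -> : (fun s => (wint (j s) (fun=> 1))^-1) =
    (fun s => expR (- ln (wint (j s) (fun=> 1)))).
  by apply/funext => s; rewrite expRN lnK// posrE wint1_gt0.
apply: measurableT_comp => //; apply: measurableT_comp => //.
exact: measurableT_comp (@measurable_ln R) m1.
Qed.

Lemma bmfun_xy_correlation a : bmfun (fun s => xy_correlation a (j s)).
Proof.
under eq_fun do rewrite xy_correlationE.
apply: bmfun_wint_ratio; first exact: bmfun_cos_phase.
by move=> t; rewrite ler_norml cos_geN1 cos_le1.
Qed.

Lemma bmfun_edge_slope a e : bmfun (j ^~ e) ->
  bmfun (fun s => edge_slope a e (j s)).
Proof.
move=> bje; pose A theta : R := cos (phase (finfun a) theta).
have bA : bmfun A := bmfun_cos_phase R (finfun a).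
have A1 t : `|A t| <= 1 by rewrite ler_norml cos_geN1 cos_le1.
have bX : bmfun (edge_cos e : config R G -> R) := bmfun_edge_cos R e.
have X1 (t : config R G) : `|edge_cos e t| <= 1 by exact: edge_cos_le1.
pose r f s : R := wint (j s) f / wint (j s) (fun=> 1).
have -> : (fun s => edge_slope a e (j s)) = (fun s => 2^-1 * expR (2 * j s e) *
    (r (fun t => A t * edge_cos e t) s - r A s * r (edge_cos e) s)).
  apply/funext => s; rewrite /edge_slope /r -/(A _); congr (_ * _).
  by field; rewrite gt_eqF// wint1_gt0.
have bC (c : R) : bmfun (fun _ : S => c) by exact: bmfun_cst.
apply: bmfunM; first by apply/bmfunM/bmfun_expR/bmfunM.
apply: bmfunB; last by apply: bmfunM; exact: bmfun_wint_ratio.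
apply: bmfun_wint_ratio; first exact: bmfunM.
by move=> t; rewrite normrM mulr_ile1.
Qed.

End bounded_correlation.

(** * Replacing random couplings by effective ones *)

Section random_couplings.
Variables (R : realType) (G : sgraph).
Context d (T : measurableType d) (P : probability T R).
Variable K : edge G -> {RV P >-> \bar R}.
Hypothesis K_ge0 : forall (e : edge G) (w : T), (0 <= K e w)%E.
Hypothesis K_fin : forall e : edge G, {ae P, forall w : T, (K e w < +oo)%E}.
Hypothesis K_indep : mutually_independent P K.

Let Kf (e : edge G) (w : T) : R := fine (K e w).
Let keff (e : edge G) : R := effective_coupling P (K e).

Let Kf_ge0 e w : 0 <= Kf e w. Proof. exact: fine_ge0. Qed.

Let measurable_Kf e : measurable_fun setT (Kf e).
Proof. by apply: measurableT_comp => //; exact: measurable_funPT. Qed.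

(* The absolute value makes the weight bounded on the whole extended line; it
   acts trivially on the nonnegative values of the couplings. *)
Let bmfun_weight : bmfun (fun y : \bar R => expR (- (2 * `|fine y|)) : R).
Proof.
split; last first.
  exists 1 => y; rewrite (ger0_norm (expR_ge0 _)) -[leRHS]expR0.
  by rewrite ler_expR oppr_le0 mulr_ge0.
apply: measurableT_comp => //; apply: measurableT_comp => //.
by apply: measurable_funM => //; apply: measurableT_comp.
Qed.

Let weightE e w : expR (- (2 * `|fine (K e w)|)) = expR (- (2 * Kf e w)).
Proof. by rewrite ger0_norm ?fine_ge0. Qed.

Let bmfun_weightK e : bmfun (fun w => expR (- (2 * Kf e w))).
Proof.
under eq_fun do rewrite -weightE.
by apply: (bmfun_comp _ bmfun_weight); exact: measurable_funPT.
Qed.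

Lemma expR_effective_coupling e :
  expR (- (2 * keff e)) = \int[P]_w expR (- (2 * Kf e w)).
Proof.
have I0 : 0 < \int[P]_w expR (- (2 * Kf e w)).
  by apply: bmint_gt0 => // w; exact: expR_gt0.
have -> : keff e = - 2^-1 * ln (\int[P]_w expR (- (2 * Kf e w))).
  rewrite /keff /effective_coupling; congr (_ * ln (fine _)).
  apply: ae_eq_integral => //.
  - have -> : (fun w => expeR (- (2%:E * K e w))) =
        (fun w => if K e w == +oo%E then 0%E else (expR (- (2 * Kf e w)))%:E).
      apply/funext => w; have := K_ge0 e w.
      by rewrite /Kf; case: (K e w) => [r| |]//= _; rewrite gt0_muley ?lte_fin.
    apply: measurable_fun_ifT => //; first exact: measurable_fun_eqe.
    by apply/measurable_EFinP; case: (bmfun_weightK e).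
  - by apply/measurable_EFinP; case: (bmfun_weightK e).
  apply: filterS (K_fin e) => w Kw _.
  have := K_ge0 e w; rewrite /Kf; case: (K e w) Kw => [r| |]//= _ _.
by rewrite mulrA mulrN mulfV// mulN1r opprK lnK.
Qed.

Lemma effective_coupling_ge0 e : 0 <= keff e.
Proof.
rewrite -(pmulr_rge0 _ (ltr0Sn R 1)) -oppr_le0 -ler_expR expR0.
rewrite expR_effective_coupling -[leRHS](bmint_cst P).
apply: bmint_le => //; first exact: bmfun_cst.
by move=> w; rewrite -[leRHS]expR0 ler_expR oppr_le0 mulr_ge0.
Qed.

(** A pi-system generating the sigma-algebra of all the couplings but that of
    e. *)
Definition other_edges_system e : set (set T) :=
  [set A | exists2 B : edge G -> set (\bar R), (forall i, measurable (B i)) &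
    A = \bigcap_(i in [set` [set~ e]%SET]) (K i @^-1` B i)].

(** Both sides are finite measures in A; they agree on the generating pi-system
    by the product rule for the whole family, hence on the sigma-algebra it
    generates. *)
Lemma independent_of_others e A (V : set (\bar R)) :
  <<s other_edges_system e >> A -> measurable V ->
  (P (A `&` K e @^-1` V) = P A * P (K e @^-1` V))%E.
Proof.
move=> GA mV; set KV := K e @^-1` V.
have mKV : measurable KV by rewrite -[KV]setTI; exact: measurable_funPT.
have PV0 : 0 <= fine (P KV) by exact: fine_ge0.
have PVE : (NngNum PV0)%:num%:E = P KV by rewrite /= fineK// fin_num_measure.
rewrite muleC -PVE.
rewrite -[LHS]/(mrestr P mKV A) -[RHS]/(mscale (NngNum PV0) P A).
have Gm : other_edges_system e `<=` measurable.
  move=> _ [B mB ->]; apply: fin_bigcap_measurable => // i _.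
  by rewrite -[X in measurable X]setTI; exact: measurable_funPT.
apply: (@g_sigma_algebra_measure_unique _ _ _ _ Gm (fun=> setT)) GA.
- move=> _; exists (fun=> setT) => //.
  by apply/seteqP; split => // w _ i _.
- by apply/seteqP; split => // w _; exists 0%N.
- move=> _ _ [B mB ->] [C mC ->]; exists (fun i => B i `&` C i).
    by move=> i; exact: measurableI.
  apply/seteqP; split => w.
    by move=> [Bw Cw] i ie; split; [exact: Bw|exact: Cw].
  by move=> BC; split => i ie; have [] := BC i ie.
- move=> _ [B mB ->]; set A0 := \bigcap_(i in _) _.
  rewrite -[LHS]/(P (A0 `&` KV)) -[RHS]/((fine (P KV))%:E * P A0)%E.
  rewrite fineK ?fin_num_measure// /A0.
  pose B' i := if i == e then V else B i.
  have mB' i : measurable (B' i) by rewrite /B'; case: ifP.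
  have -> : \bigcap_(i in [set` [set~ e]%SET]) (K i @^-1` B i) `&` KV =
      \bigcap_(i in [set` [set: edge G]%SET]) (K i @^-1` B' i).
    apply/seteqP; split => w /=.
      move=> [Bw Vw] i _; rewrite /B'; case: eqP => [->//|/eqP ie].
      by apply: Bw; rewrite /= !inE.
    move=> Bw; split=> [i|].
      rewrite /= !inE => ie; have := Bw i; rewrite /B' (negPf ie); apply.
      by rewrite /= inE.
    by have := Bw e; rewrite /B' eqxx; apply; rewrite /= inE.
  rewrite !K_indep// (bigD1 e) ?inE//= /B' eqxx; congr (_ * _)%E.
  apply: eq_big => [i|i]; first by rewrite !inE.
  by rewrite inE/= => /negPf ->.
- move=> _; rewrite [ltLHS]/(P (setT `&` KV)) setTI.
  by rewrite (le_lt_trans (probability_le1 P mKV))// ltry.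
Qed.

Let measurable_Kf_others e e' : e' != e ->
  measurable_fun setT (Kf e' : g_sigma_algebraType (other_edges_system e) -> R).
Proof.
move=> e'e _ B mB; apply: sub_sigma_algebra; rewrite setTI.
have mfB : measurable (fine @^-1` B : set (\bar R)).
  by rewrite -[X in measurable X]setTI; exact: fine_measurable.
exists (fun i => if i == e' then fine @^-1` B else setT).
  by move=> i; case: ifP.
apply/seteqP; split => w /=.
  by move=> Bw i _; case: eqP => [->|].
by move=> /(_ e'); rewrite /= eqxx; apply; rewrite !inE.
Qed.

Variable a : G -> int.

(* The couplings in the course of the replacement, r being the edges already
   treated. *)
Let mixed (r : seq (edge G)) (w : T) (e : edge G) : R :=
  if e \in r then keff e else Kf e w.

Let mixed_ge0 r w e : 0 <= mixed r w e.
Proof. by rewrite /mixed; case: ifP => // _; exact: effective_coupling_ge0. Qed.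

Let measurable_mixed r e : measurable_fun setT (mixed r ^~ e).
Proof. by rewrite /mixed; case: (e \in r). Qed.

(** The slope at K_e^eff is a function of the couplings of the other edges,
    hence independent of e^(-2 K_e), whose mean is e^(-2 K_e^eff): the tangent
    term integrates to zero. *)
Lemma replace_one_coupling (r : seq (edge G)) e : e \notin r ->
  \int[P]_w xy_correlation a (mixed (e :: r) w) <=
  \int[P]_w xy_correlation a (mixed r w).
Proof.
move=> er; rewrite -subr_ge0.
have bC s : bmfun (fun w => xy_correlation a (mixed s w)).
  by apply: bmfun_xy_correlation => e'; exact: measurable_mixed.
rewrite -bmintB//.
pose TG := g_sigma_algebraType (other_edges_system e).
pose q (w : T) := edge_slope a e (mixed (e :: r) w).
(* q is measurable for the sigma-algebra generated by the other edges. *)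
have bq : bmfun (q : TG -> R).
  apply: bmfun_edge_slope => [e'|].
    rewrite /mixed; case: (boolP (e' \in _)) => //.
    rewrite inE negb_or => /andP[e'e _].
    exact: measurable_Kf_others.
  by rewrite /mixed mem_head; exact: bmfun_cst.
have bqT : bmfun q.
  apply: bmfun_edge_slope => [e'|]; first exact: measurable_mixed.
  by rewrite /mixed mem_head; exact: bmfun_cst.
pose y := expR (- (2 * keff e)).
have by' : bmfun (fun w => y - expR (- (2 * Kf e w))).
  by apply: bmfunB => //; exact: bmfun_cst.
apply: (@le_trans _ _ (\int[P]_w (q w * (y - expR (- (2 * Kf e w))))));
  last first.
  apply: bmint_le; [exact: bmfunM|exact: bmfunB|] => w.
  have := @xy_correlation_support _ _ a e (mixed (e :: r) w) (Kf e w)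
    (mixed_ge0 _ _) (Kf_ge0 _ _).
  rewrite /q {2}/mixed mem_head -/y.
  suff -> : set_coupling (mixed (e :: r) w) e (Kf e w) = mixed r w by [].
  apply/funext => e'; rewrite /set_coupling /mixed inE.
  by case: eqP => [->|//]; rewrite (negPf er).
pose g (z : \bar R) := y - expR (- (2 * `|fine z|)).
have gE w : y - expR (- (2 * Kf e w)) = g (K e w) by rewrite /g weightE.
have -> : \int[P]_w (q w * (y - expR (- (2 * Kf e w)))) =
    (\int[P]_w q w) * (\int[P]_w (y - expR (- (2 * Kf e w)))).
  under eq_Rintegral do rewrite gE.
  under [X in _ = _ * X]eq_Rintegral do rewrite gE.
  apply: (@bmint_indep _ _ _ P _ _ TG (\bar R) id (K e) q g) => //.
  - move=> _ B GB; rewrite setTI; apply: (smallest_sub _ _ GB).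
      exact: sigma_algebra_measurable.
    move=> _ [C mC ->]; apply: fin_bigcap_measurable => // i _.
    by rewrite -[X in measurable X]setTI; exact: measurable_funPT.
  - by apply: bmfunB => //; exact: bmfun_cst.
  - by move=> U V GU mV; exact: independent_of_others.
rewrite bmintB//; last exact: bmfun_cst.
by rewrite bmint_cst -expR_effective_coupling subrr mulr0.
Qed.

Lemma replace_couplings (r : seq (edge G)) : uniq r ->
  \int[P]_w xy_correlation a (mixed r w) <=
  \int[P]_w xy_correlation a (Kf ^~ w).
Proof.
elim: r => [_|e r IHr /= /andP[er /IHr]].
  by rewrite le_eqVlt; apply/orP; left; apply/eqP; apply: eq_Rintegral.
exact/le_trans/replace_one_coupling.
Qed.

Lemma correlation_effective_le :
  xy_correlation a keff <= \int[P]_w xy_correlation a (Kf ^~ w).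
Proof.
apply: le_trans (replace_couplings (enum_uniq (edge G))).
rewrite -[leLHS](bmint_cst P) le_eqVlt; apply/orP; left; apply/eqP.
apply: eq_Rintegral => w _; congr (xy_correlation a _); apply/funext => e.
by rewrite /mixed mem_enum.
Qed.

End random_couplings.

Theorem theorem2p3 (R : realType) (G : sgraph)
    (d : measure_display) (T : measurableType d) (P : probability T R)
    (K : edge G -> {RV P >-> \bar R})
    (K_ge0 : forall (e : edge G) (w : T), (0 <= K e w)%E)
    (K_fin : forall e : edge G, {ae P, forall w : T, (K e w < +oo)%E})
    (K_indep : mutually_independent P K)
    (a : G -> int) :
  ((xy_correlation a (fun e : edge G => effective_coupling P (K e)))%:E
    <= 'E_P[fun w : T => xy_correlation a (fun e : edge G => fine (K e w))])%E.
Proof.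
rewrite unlock /= bmint_EFin ?lee_fin.
  exact: correlation_effective_le.
apply: bmfun_xy_correlation => e; apply: measurableT_comp => //.
Qed.
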